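(* Let $p$ be a prime number, and let $D$ be a principal ideal domain such that $p$ is a prime element of $D$. Let $(N,+,\circ)$ be a $D$-brace whose order is a power of $p$. Assume that $r=\mathrm{rank}_D N<p-1$. Then $(N,+)$ and $(N,\circ)$ have the same number of elements of each order. In particular, if $(N,\circ)$ is abelian, then $(N,+)\cong(N,\circ)$ as groups.
   Context: A (left) brace is a set $N$ with two group operations $+$ and $\circ$, with $(N,+)$ abelian, such that $x\circ(y+z)=(x\circ y)-x+(x\circ z)$ for all $x,y,z\in N$. Its gamma function is $x\mapsto\gamma_x$, where $\gamma_x(y)=-x+x\circ y$; each $\gamma_x$ is an automorphism of $(N,+)$. Given a ring $R$, an $R$-brace is a brace $(N,+,\circ)$ such that $(N,+)$ is an $R$-module and every $\gamma_x$ ($x\in N$) is an automorphism of $R$-modules. For a PID $D$ and a finite (torsion) $D$-module $M$, $\mathrm{rank}_D M$ denotes the number of summands in the (essentially unique) decomposition of $M$ as a direct sum of nonzero indecomposable cyclic $D$-modules. *)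

(* Defs.v *)
From HB Require Import structures.
From mathcomp Require Import all_boot all_order all_algebra all_fingroup.

Set Implicit Arguments.
Unset Strict Implicit.
Unset Printing Implicit Defensive.

Import GRing.Theory.
Local Open Scope ring_scope.

Definition is_ideal (R : comNzRingType) (I : R -> Prop) : Prop :=
  [/\ I 0, forall x y, I x -> I y -> I (x + y) & forall a x, I x -> I (a * x)].

(* The carrier being an idomainType, this says that D is a PID. *)
Definition is_pid (D : idomainType) : Prop :=
  forall I : D -> Prop, is_ideal I ->
    exists a : D, forall x, I x <-> exists b, x = b * a.

Definition divides (R : comNzRingType) (a b : R) : Prop := exists c, b = c * a.

Definition prime_element (D : idomainType) (a : D) : Prop :=
  [/\ a != 0, a \isn't a GRing.unit &
      forall x y : D, divides a (x * y) -> divides a x \/ divides a y].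

Record leftBrace (N : zmodType) := LeftBrace {
  circ : N -> N -> N;
  circ_one : N;
  circ_inv : N -> N;
  circA : associative circ;
  circ1x : left_id circ_one circ;
  circx1 : right_id circ_one circ;
  circVx : left_inverse circ_one circ_inv circ;
  circxV : right_inverse circ_one circ_inv circ;
  circDr : forall x y z, circ x (y + z) = circ x y - x + circ x z
}.

Definition gamma (N : zmodType) (B : leftBrace N) (x y : N) : N :=
  - x + circ B x y.

Definition is_module_aut (R : nzRingType) (M : lmodType R) (f : M -> M) : Prop :=
  linear f /\ bijective f.

Record moduleBrace (R : nzRingType) (N : lmodType R) := ModuleBrace {
  brace_of :> leftBrace N;
  gamma_aut : forall x, is_module_aut (gamma brace_of x)
}.

(* A copy of the carrier N whose (multiplicative) group law is circ; the group
   structure that a finite module carries itself is its additive one. *)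
Definition circ_group (N : zmodType) (B : leftBrace N) : Type := N.

HB.instance Definition _ (N : zmodType) (B : leftBrace N) :=
  Choice.copy (circ_group B) N.
HB.instance Definition _ (N : zmodType) (B : leftBrace N) :=
  isGroup.Build (circ_group B)
    (circA B) (circ1x B) (circx1 B) (circVx B) (circxV B).
HB.instance Definition _ (R : nzRingType) (N : finLmodType R) (B : leftBrace N) :=
  Finite.copy (circ_group B) N.

Section Rank.

Variables (R : nzRingType) (M : finLmodType R).

Definition cyclic_submod (S : {set M}) : Prop :=
  exists x : M, forall y, y \in S <-> exists a : R, y = a *: x.

(* The products of sets are taken in the additive group of M, so that dprod is
   the internal direct sum and 1%g is the zero submodule. *)
Definition indecomposable (S : {set M}) : Prop :=
  forall A B : {set M}, GRing.submod_closed A -> GRing.submod_closed B ->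
    (A \x B = S -> A = 1 \/ B = 1)%g.

Definition cyclic_decomposition (r : nat) (S : 'I_r -> {set M}) : Prop :=
  (forall i, [/\ GRing.submod_closed (S i), S i <> 1%g,
                 cyclic_submod (S i) & indecomposable (S i)]) /\
  (\big[dprod/1]_(i < r) S i = [set: M])%g.

(* A relation rather than a function: over a PID, the case of interest, exactly
   one r satisfies it. *)
Definition has_rank (r : nat) : Prop :=
  exists S : 'I_r -> {set M}, cyclic_decomposition S.

End Rank.

(* Main.v *)
Require Import Defs.
From HB Require Import structures.
From mathcomp Require Import all_boot all_order all_algebra all_fingroup.
From mathcomp Require Import all_solvable boolp zify ring.

(** The two groups agree element by element: every [x] has the same order in
    [(N, +)] and in [(N, circ)] (lemma [order_circ]).  Counting elements of each
    order is then immediate, and a finite abelian p-group is determined up to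
    isomorphism by such counts ([abelian_pgroup_isog]).

    Fix [x] and put [delta = gamma_x - 1], a [D]-linear endomorphism of [N].  Let
    the polynomial ring [D[X]] act on [N] with [X] acting as [delta].  From
    [x circ y = x + gamma_x y] and [gamma_x = 1 + X] one gets the power formula
    [x^n = (1 + (1 + X) + ... + (1 + X)^(n - 1)) x] for the law [circ], and for
    [n = p] the binomial theorem turns the polynomial into
    [X^(p - 1) + p (1 + X g)].  The middle binomial coefficients are divisible by
    [p]; the trouble is the term [X^(p - 1)], and this is where the rank enters.

    The action of [(N, circ)] through [gamma] is that of a p-group on a p-group,
    so [delta] is nilpotent: [(1 + X)^(p^k)] acts trivially and is congruent to
    [1 + X^(p^k)] modulo [p], hence [X^(p^k)] maps [N] into [pN], and iterating
    kills [N].  A nilpotent endomorphism of a vector space of dimension at most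
    [r] has zero [r]-th power; applied to [V / pV] for the [D[X]]-submodule
    [V = D[X] x], this says [X^r x = p h x] for some polynomial [h].  Applying
    it to [V] rather than to [N] is the crux, since it makes the right-hand side
    a multiple of [x] itself.  As [p - 1 > r], the offending term is
    [X^(p - 1) x = p X (...) x], so that [x^p = (1 + X g') p x] for the law
    [circ].  The operator [1 + X g'] is invertible, because [X] is nilpotent,
    and therefore [x^p] and [p x] have the same additive annihilating powers of
    [p].  Induction gives [x^(p^m) = 1] if and only if [p^m x = 0].

    The dimension bound on [V / pV] is obtained by counting
    ([iter_nilpotent_submod]).  With [q] the cardinal of the residue field,
    [V / pV] and [{v in V | p v = 0}] have the same cardinal, the latter lies in
    [{x in N | p x = 0}], and this has at most [q^r] elements since each of the
    [r] cyclic summands contributes at most [q] ([card_torsion_le_rank]).  On the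
    other hand a strictly decreasing chain of submodules between [V] and [pV]
    loses a factor at least [q] at each step ([card_proper_submod]). *)

Set Implicit Arguments.
Unset Strict Implicit.
Unset Printing Implicit Defensive.

Import GRing.Theory.

(** * The polynomial-ring module defined by an endomorphism *)

Section PolynomialAction.
Local Open Scope ring_scope.

(** A copy of [N], to carry the [D[X]]-module structure in which ['X] acts as
    [d]; the parameter [d] keeps the actions of distinct endomorphisms apart. *)
Definition polymod (D : comNzRingType) (N : lmodType D) (d : {linear N -> N})
  : Type := N.

HB.instance Definition _ (D : comNzRingType) (N : lmodType D)
  (d : {linear N -> N}) := GRing.Zmodule.copy (polymod d) N.

Variables (D : comNzRingType) (N : lmodType D) (d : {linear N -> N}).

Definition polyact (f : {poly D}) (v : N) : N :=
  \sum_(i < size f) f`_i *: iter i d v.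

(** A summation range independent of the exact degree, which makes additivity
    in [f] visible despite possible cancellation of leading terms. *)
Lemma polyact_widen n (f : {poly D}) v :
  (size f <= n)%N -> polyact f v = \sum_(i < n) f`_i *: iter i d v.
Proof.
move=> le_fn; rewrite /polyact (big_ord_widen n (fun i => f`_i *: iter i d v)) //.
rewrite big_mkcond; apply: eq_bigr => i _; case: ltnP => // le_fi.
by rewrite nth_default ?scale0r.
Qed.

Lemma iter_linear i a u v : iter i d (a *: u + v) = a *: iter i d u + iter i d v.
Proof. by elim: i => //= i ->; rewrite linearP. Qed.

Lemma polyact_linear f a u v :
  polyact f (a *: u + v) = a *: polyact f u + polyact f v.
Proof.
rewrite /polyact scaler_sumr -big_split; apply: eq_bigr => i _ /=.
by rewrite iter_linear scalerDr !scalerA mulrC.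
Qed.

Lemma polyactDr f : {morph polyact f : u v / u + v}.
Proof. by move=> u v; have:= polyact_linear f 1 u v; rewrite !scale1r. Qed.

Lemma polyactDl v : {morph polyact^~ v : f g / f + g}.
Proof.
move=> f g; pose n := maxn (size f) (size g).
rewrite !(@polyact_widen n) ?leq_maxl ?leq_maxr ?size_polyD //.
by rewrite -big_split; apply: eq_bigr => i _; rewrite coefD scalerDl.
Qed.

Lemma polyactC c v : polyact c%:P v = c *: v.
Proof.
by rewrite (@polyact_widen 1) ?size_polyC_leq1 // big_ord1 coefC.
Qed.

Lemma polyactCM c f v : polyact (c%:P * f) v = c *: polyact f v.
Proof.
rewrite (@polyact_widen (size f)); last first.
  by rewrite mul_polyC size_scale_leq.
by rewrite /polyact scaler_sumr; apply: eq_bigr => i _; rewrite coefCM scalerA.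
Qed.

Lemma polyactXM f v : polyact ('X * f) v = d (polyact f v).
Proof.
rewrite (@polyact_widen (size f).+1); last first.
  by rewrite (leq_trans (size_polyMleq _ _)) // size_polyX.
rewrite big_ord_recl coefXM scale0r add0r linear_sum.
by apply: eq_bigr => i _; rewrite coefXM /= linearZ.
Qed.

Lemma polyactM f g v : polyact (f * g) v = polyact f (polyact g v).
Proof.
elim/poly_ind: f => [|f c IHf].
  by rewrite mul0r /polyact size_poly0 !big_ord0.
by rewrite mulrDl !polyactDl polyactCM polyactC ![f * _]mulrC -mulrA !polyactXM IHf.
Qed.

Lemma polyact1 : left_id 1 polyact.
Proof. by move=> v; rewrite polyactC scale1r. Qed.

HB.instance Definition _ := GRing.Zmodule_isLmodule.Build {poly D} (polymod d)
  (fun f g v => esym (polyactM f g v)) polyact1 polyactDr polyactDl.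

Lemma polymod_scaleC c (v : N) : c%:P *: (v : polymod d) = c *: v.
Proof. exact: polyactC. Qed.

Lemma polymod_scaleX (v : N) : 'X *: (v : polymod d) = d v.
Proof.
by have := polyactXM 1 v; rewrite mulr1 polyact1.
Qed.

Lemma polymod_scaleXn n (v : N) : 'X^n *: (v : polymod d) = iter n d v.
Proof.
elim: n => [|n IHn]; first by rewrite expr0 scale1r.
by rewrite exprS -scalerA IHn polymod_scaleX.
Qed.

Lemma polymod_scale_nat n (v : N) : n%:R *: (v : polymod d) = v *+ n.
Proof. by rewrite -polyC_natr polymod_scaleC scaler_nat. Qed.
End PolynomialAction.

(** * Binomial expansions modulo a prime *)

Section PrimePowerExpansions.
Local Open Scope ring_scope.
Variable (p : nat).
Hypothesis (p_pr : prime p).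

Lemma exprDn_prime (R : comNzRingType) (a b : R) :
  exists g, (a + b) ^+ p = a ^+ p + b ^+ p + p%:R * g.
Proof.
case: p p_pr => // q q_pr.
pose c i := ('C(q.+1, i) %/ q.+1)%N.
exists (\sum_(i < q) (a ^+ (q.+1 - i.+1) * b ^+ i.+1) *+ c i.+1).
rewrite exprDn big_ord_recl big_ord_recr /= subn0 expr0 mulr1 bin0 mulr1n.
rewrite /bump /= add1n subnn expr0 mul1r binn mulr1n -addrA; congr (_ + _).
rewrite addrC mulr_sumr; congr (_ + _); apply: eq_bigr => i _.
rewrite /bump /= add1n mulr_natl -mulrnA /c divnK ?prime_dvd_bin //=.
by rewrite ltnS ltn_ord.
Qed.

(** Raising [1 + x^(p^k) + p g] to the power [p] keeps its shape: apply
    [exprDn_prime] once to split off [p g] and once to the remaining sum. *)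
Lemma exprD1_ppow (R : comNzRingType) (x : R) k :
  exists g, (1 + x) ^+ (p ^ k) = 1 + x ^+ (p ^ k) + p%:R * g.
Proof.
elim: k => [|k [g IHk]]; first by exists 0; rewrite mulr0 addr0 expn0 !expr1.
rewrite expnSr !exprM IHk.
have [g1 ->] := exprDn_prime (1 + x ^+ (p ^ k)) (p%:R * g).
have [g2 ->] := exprDn_prime 1 (x ^+ (p ^ k)).
exists (g2 + p%:R ^+ p.-1 * g ^+ p + g1).
have Dpp : p%:R ^+ p = p%:R * p%:R ^+ p.-1 :> R.
  by rewrite -exprS prednK ?prime_gt0.
by rewrite expr1n exprMn Dpp !mulrDr !mulrA !addrA.
Qed.

(** The sum [s] satisfies [X s = (1 + X)^p - 1 = X^p + p h].  Evaluating at [0]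
    shows that [X] divides [h], and evaluating the quotient relation at [0],
    where [s] takes the value [p], shows that the cofactor of [p] in [s] has
    constant term [1].  Both steps cancel [p], hence [p != 0] in [D]. *)
Lemma sum_exprD1X (D : idomainType) : p%:R != 0 :> D ->
  exists g : {poly D},
    \sum_(j < p) (1 + 'X) ^+ j = 'X ^+ p.-1 + p%:R * (1 + 'X * g).
Proof.
move=> p_nz.
pose s : {poly D} := \sum_(j < p) (1 + 'X) ^+ j.
have [h Dh] := exprDn_prime 1 ('X : {poly D}).
have Ds : 'X * s = 'X * 'X ^+ p.-1 + p%:R * h.
  rewrite -exprS prednK ?prime_gt0 //.
  have := subrX1 (1 + 'X : {poly D}) p; rewrite addrAC subrr add0r => <-.
  by rewrite Dh expr1n [LHS]addrC -addrA addKr.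
have factorX (f : {poly D}) : f.[0] = 0 -> exists g, f = 'X * g.
  move/eqP/factor_theorem => [g ->]; exists g.
  by rewrite subr0 mulrC.
have [h1 Dh1] : exists h1, h = 'X * h1.
  apply: factorX; have/(congr1 (fun f => f.[0])) := Ds.
  rewrite !hornerE /= -polyC_natr hornerC.
  by move/esym/eqP; rewrite mulf_eq0 (negPf p_nz) => /eqP.
have {}Ds : s = 'X ^+ p.-1 + p%:R * h1.
  apply: (mulfI (negbT (polyX_eq0 D))).
  by rewrite Ds Dh1 mulrDr [_%:R * (_ * _)]mulrCA.
have [g Dg] : exists g, h1 - 1 = 'X * g.
  apply: factorX; apply: (mulfI p_nz); rewrite mulr0.
  have/(congr1 (fun f => f.[0])) := Ds.
  rewrite /s horner_sum (eq_bigr (fun=> 1)) => [|j _].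
    rewrite sumr_const card_ord !hornerE /= -polyC_natr hornerC.
    rewrite expr0n -subn1 subn_eq0 leqNgt prime_gt1 // add0r => Dp.
    by rewrite mulrBr mulr1 -Dp subrr.
  by rewrite horner_exp !hornerE expr1n.
by exists g; rewrite -Dg [1 + (_ - _)]addrC subrK -Ds.
Qed.
End PrimePowerExpansions.

(** * Finite primary modules of bounded rank *)

Section PrimaryModules.
Local Open Scope ring_scope.
Variables (D : idomainType) (t : D).
Hypotheses (D_pid : is_pid D) (t_prime : prime_element t).

(** In a PID a nonzero prime ideal is maximal: a generator [e] of [(b, t)]
    divides [t], so it is either a unit or an associate of [t], and the second
    case would make [t] divide [b]. *)
Lemma prime_bezout b : ~ divides t b -> exists u v, u * b + v * t = 1.
Proof.
move=> ndiv_tb; have [t_nz t_nu t_dvd] := t_prime.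
pose I x := exists u v, x = u * b + v * t.
have [] := D_pid (I := I).
  split=> [|x y [u [v ->]] [u' [v' ->]]|a x [u [v ->]]].
  - by exists 0, 0; rewrite !mul0r addr0.
  - by exists (u + u'), (v + v'); rewrite !mulrDl addrACA.
  - by exists (a * u), (a * v); rewrite mulrDr !mulrA.
move=> e De.
have [f Dt] : exists f, t = f * e.
  by apply/De; exists 0, 1; rewrite mul0r add0r mul1r.
have [h Db] : exists h, b = h * e.
  by apply/De; exists 1, 0; rewrite mul0r addr0 mul1r.
have [|[c Df]|[c Dc]] := t_dvd f e; first by exists 1; rewrite mul1r.
  have ce1 : c * e = 1.
    by apply: (mulfI t_nz); rewrite mulr1 {2}Dt Df mulrA [t * c]mulrC.
  have [u [v Duv]] : I 1 by apply/De; exists c.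
  by exists u, v.
by case: ndiv_tb; exists (h * c); rewrite Db Dc mulrA.
Qed.

Variable N : finLmodType D.
Implicit Types (A B V W : {set N}) (x y z : N).

Definition line x : {set N} := [set y | `[< exists a : D, y = a *: x >]].

Definition torsion : {set N} := [set z | t *: z == 0].

Lemma lineP x y : reflect (exists a : D, y = a *: x) (y \in line x).
Proof. by rewrite inE; apply: asboolP. Qed.

Lemma prime_scale_eq0 b x k :
  t ^+ k *: x = 0 -> b *: x = 0 -> ~ divides t b -> x = 0.
Proof.
move=> tx0 bx0 /prime_bezout[u [v uv1]].
have Dx : x = (v * t) *: x.
  by rewrite -{1}(scale1r x) -uv1 scalerDl -[(u * b) *: x]scalerA bx0 scaler0 add0r.
have Dxn n : x = (v * t) ^+ n *: x.
  by elim: n => [|n IHn]; rewrite ?scale1r // exprS -scalerA -IHn.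
by rewrite (Dxn k) exprMn -scalerA tx0 scaler0.
Qed.

(** If [t^(m + 1)] is the exact annihilating power of [x], then [a x] is killed
    by [t] only when [t^m] divides [a]: if exactly [t^j] with [j < m] divided
    [a], the cofactor, being invertible modulo powers of [t], could be cancelled
    to give [t^(j + 1) x = 0].  So [z = t^m x] generates the [t]-torsion. *)
Lemma torsion_cyclic x k : t ^+ k *: x = 0 ->
  exists2 z, z \in torsion & line x :&: torsion \subset line z.
Proof.
move=> tx0.
have exP : exists m, t ^+ m *: x == 0 by exists k; rewrite tx0.
case: (ex_minnP exP) => -[|m] /eqP tmx0 m_min.
  exists 0; first by rewrite inE scaler0.
  rewrite expr0 scale1r in tmx0.
  apply/subsetP=> y /setIP[/lineP[a ->] _]; rewrite tmx0.
  by apply/lineP; exists 0; rewrite !scaler0.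
exists (t ^+ m *: x); first by rewrite inE scalerA -exprS tmx0.
apply/subsetP=> _ /setIP[/lineP[a ->]]; rewrite inE scalerA => /eqP tax0.
have dvd_a j : (j <= m)%N -> divides (t ^+ j) a.
  elim: j => [|j IHj] le_jm; first by exists a; rewrite mulr1.
  have [b Da] := IHj (ltnW le_jm).
  have [[c Db] | ndiv] := pselect (divides t b).
    by exists c; rewrite Da Db exprS mulrA.
  suffices /eqP/m_min: t ^+ j.+1 *: x = 0 by rewrite leqNgt ltnS le_jm.
  apply: (@prime_scale_eq0 b _ k) => //.
    by rewrite scalerA mulrC -scalerA tx0 scaler0.
  by rewrite scalerA -tax0 Da exprS mulrCA.
have [b ->] := dvd_a m (leqnn m).
by apply/lineP; exists b; rewrite scalerA.
Qed.

Lemma submodZ A a x : GRing.submod_closed A -> x \in A -> a *: x \in A.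
Proof. by case=> A0 clA Ax; rewrite -[_ *: _]addr0 clA. Qed.

Lemma submodD A x y :
  GRing.submod_closed A -> x \in A -> y \in A -> x + y \in A.
Proof. by case=> _ clA Ax Ay; rewrite -[x]scale1r clA. Qed.

(** The cardinal of the residue field [D / tD] when the [t]-torsion of [N] is
    nonzero, for then [D z] is a copy of this field for each nonzero torsion
    element [z]; otherwise [1]. *)
Definition residue_card := \max_(z in torsion) #|line z|.

Lemma residue_card_attained : exists2 z, z \in torsion & residue_card = #|line z|.
Proof.
have: (0 < #|[in torsion]|)%N by apply/card_gt0P; exists 0; rewrite inE scaler0.
by case/(@eq_bigmax_cond N [in torsion] (fun z => #|line z|)) => z; exists z.
Qed.

(** Each torsion element is a sum of torsion elements of the cyclic summands,
    by uniqueness of the decomposition of [0]. *)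
Lemma card_torsion_le_rank r :
    has_rank N r -> (forall x, exists k, t ^+ k *: x = 0) ->
  (#|torsion| <= residue_card ^ r)%N.
Proof.
case=> S [cS dxS] tN0.
pose T i := S i :&: torsion.
have le_T i : (#|T i| <= residue_card)%N.
  have [_ _ [x Sx] _] := cS i; have [k tx0] := tN0 x.
  have [z tz sTz] := torsion_cyclic tx0.
  apply: leq_trans (leq_bigmax_cond _ tz); apply: subset_leq_card.
  apply: subset_trans sTz; apply: setSI; apply/subsetP=> y /Sx Dy.
  exact/lineP.
pose F := family (fun i => mem (T i)).
have sTF : torsion \subset [set \sum_i f i | f : {ffun 'I_r -> N} in F].
  apply/subsetP=> x; rewrite inE => /eqP tx0.
  have [c [Sc Dx _]] := mem_bigdprod dxS (in_setT x).
  apply/imsetP; exists [ffun i => c i]; last first.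
    by rewrite Dx; apply: eq_bigr => i _; rewrite ffunE.
  apply/familyP => i; rewrite ffunE; apply/setIP; split; first exact: Sc.
  rewrite inE.
  have [c0 [_ _ uniq0]] := mem_bigdprod dxS (in_setT 0).
  rewrite (uniq0 (fun i => t *: c i)) => // [|j _|].
  - rewrite -(uniq0 (fun=> 0)) // => [j _|]; last by rewrite [RHS]big1.
    by have [[]] := cS j.
  - by apply: submodZ (Sc j isT); have [] := cS j.
  - by rewrite -[RHS]/(\sum_j t *: c j) -scaler_sumr -[X in _ *: X]Dx tx0.
rewrite (leq_trans (subset_leq_card sTF)) // (leq_trans (leq_imset_card _ _)) //.
rewrite card_family /image_mem -[X in (_ <= _ ^ X)%N]card_ord.
rewrite [in X in (_ <= X)%N]cardE.
by elim: (enum 'I_r) => //= i s IHs; rewrite expnS leq_mul.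
Qed.

(** For [y] in [B] outside [A], the annihilator of [y] modulo [A] is [tD], which
    kills any torsion element [z].  So the pairs of an element [w = c z] of [D z]
    and an [a] in [A] are told apart by the elements [a + c y] of [B]. *)
Lemma card_proper_submod A B :
  GRing.submod_closed A -> GRing.submod_closed B -> A \proper B ->
  (forall x, x \in B -> t *: x \in A) -> (residue_card * #|A| <= #|B|)%N.
Proof.
move=> clA clB /properP[sAB [y By nAy]] tBA.
have [z tz ->] := residue_card_attained.
(* a coefficient of w along z *)
pose c w : D :=
  if pselect (exists a : D, w = a *: z) is left e then projT1 (cid e) else 0.
have cP w : w \in line z -> w = c w *: z.
  by move/lineP => e; rewrite /c; case: pselect => // e'; case: cid.
have dvdA a : a *: y \in A -> a *: z = 0.
  have [[b ->] _ | /prime_bezout[u [v uv1]] Aay] := pselect (divides t a).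
    by move: tz; rewrite inE -scalerA => /eqP->; rewrite scaler0.
  case/negP: nAy; rewrite -(scale1r y) -uv1 scalerDl -!scalerA.
  by apply: submodD => //; apply: submodZ => //; apply: tBA.
pose f (wa : N * N) := wa.2 + c wa.1 *: y.
rewrite -cardsX -(@card_in_imset _ _ f); last first.
  move=> [w a] [w' a'] /setXP[/= zw Aa] /setXP[/= zw' Aa']; rewrite /f /= => eq_f.
  have Acy : (c w - c w') *: y \in A.
    have -> : (c w - c w') *: y = -1 *: a + a'.
      rewrite scalerBl scaleN1r; apply: (addrI a); rewrite addrA eq_f.
      by rewrite addrK addNKr.
    exact: clA.2.
  have eq_w : w = w'.
    by apply/eqP; rewrite -subr_eq0 (cP w) // (cP w') // -scalerBl dvdA.
  by move: eq_f; rewrite eq_w => /addIr->.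
apply: subset_leq_card; apply/subsetP=> _ /imsetP[[w a] /setXP[/= _ Aa] ->].
by apply: submodD (submodZ _ _ _) => //; apply: (subsetP sAB).
Qed.

(** The fibres of multiplication by [t] on [V] are translates of subsets of the
    torsion, the translation being by a chosen preimage. *)
Lemma card_submod_le V : (#|V| <= #|[set t *: v | v in V]| * #|torsion|)%N.
Proof.
pose f v := (t *: v, v - odflt 0 [pick u in V | t *: u == t *: v]).
rewrite -(@card_in_imset _ _ f V) => [|u v _ _]; last first.
  by rewrite /f => -[-> /addIr].
rewrite -cardsX; apply: subset_leq_card; apply/subsetP=> _ /imsetP[v Vv ->].
rewrite inE /= imset_f //= inE; case: pickP => [u /andP[_ /eqP eq_tu] | /(_ v)].
  by rewrite scalerBr eq_tu subrr.
by rewrite /= Vv eqxx.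
Qed.

Variable d : {linear N -> N}.

(** A nilpotent endomorphism of an [r]-dimensional space has zero [r]-th power,
    for the space [V / tV].  The submodules [W i = d^i V + tV] decrease
    strictly until they reach [tV], since [W = d W + tV] iterates to
    [W = d^n W + tV = tV].  Were [W r] larger than [tV], the index of [tV] in [V]
    would be at least [residue_card ^ r.+1], against the bound
    [residue_card ^ r] given by the rank. *)
Theorem iter_nilpotent_submod r V n v : has_rank N r ->
  (forall x, exists k, t ^+ k *: x = 0) -> (forall x, iter n d x = 0) ->
  GRing.submod_closed V -> (forall u, u \in V -> d u \in V) -> v \in V ->
  exists2 u, u \in V & iter r d v = t *: u.
Proof.
move=> rNr tN0 dn0 clV dV Vv.
pose tV := [set t *: u | u in V].
pose step W := [set d w + t *: u | w in W, u in V].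
pose W i := iter i step V.
have clW i : GRing.submod_closed (W i) /\ W i \subset V.
  elim: i => [|i [[W0 clWi] sWV]] //; split; last first.
    apply/subsetP=> _ /imset2P[w u /(subsetP sWV) Vw Vu ->].
    by rewrite submodD ?submodZ ?dV.
  split=> [|a _ _ /imset2P[w u Ww Vu ->] /imset2P[w' u' Ww' Vu' ->]].
    by apply/imset2P; exists 0 0; rewrite ?clV.1 // linear0 scaler0 addr0.
  apply/imset2P; exists (a *: w + w') (a *: u + u'); rewrite ?clV.2 ?clWi //.
  by rewrite linearP !scalerDr !scalerA [t * a]mulrC addrACA.
have clWi i := (clW i).1; have sWV i := (clW i).2.
have stVW i : tV \subset W i.
  case: i => [|i]; apply/subsetP=> _ /imsetP[u Vu ->]; first exact: submodZ.
  by apply/imset2P; exists 0 u => //; rewrite ?(clWi i).1 // linear0 add0r.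
have sWS i : W i.+1 \subset W i.
  elim: i => [|i IHi]; first exact: sWV 1%N.
  exact: imset2S.
have stable i : W i.+1 = W i -> W i = tV.
  move=> eqW; apply/eqP; rewrite eqEsubset stVW andbT; apply/subsetP=> w Ww.
  have [w' _ [u Vu ->]] : exists2 w', w' \in W i &
      exists2 u, u \in V & w = iter n d w' + t *: u.
    elim: n {dn0} => [|m [w' Ww' [u Vu ->]]].
      by exists w => //; exists 0; rewrite ?clV.1 // scaler0 addr0.
    move: Ww'; rewrite -{1}eqW => /imset2P[w1 u1 Ww1 Vu1 ->]; exists w1 => //.
    exists (iter m d u1 + u).
      by apply: submodD => //; elim: (m) => //= k; apply: dV.
    rewrite iterSr [d w1 + _]addrC iter_linear scalerDr addrA.
    by congr (_ + _); apply: addrC.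
  by rewrite dn0 add0r imset_f.
have index i : W i != tV -> (residue_card ^ i * #|W i| <= #|V|)%N.
  elim: i => [|i IHi] ntW; first by rewrite mul1n.
  have ntWi : W i != tV.
    apply: contraNneq ntW => eqWi.
    by rewrite eqEsubset stVW andbT -eqWi sWS.
  apply: leq_trans (IHi ntWi); rewrite expnSr -mulnA leq_mul2l.
  rewrite card_proper_submod ?orbT //.
    by rewrite properEneq sWS andbT; apply: contraNneq ntWi => /stable->.
  by move=> x Wx; apply/(subsetP (stVW i.+1))/imset_f/(subsetP (sWV i)).
suffices WrV : W r = tV.
  have: iter r d v \in W r.
    elim: (r) => //= i IHi; apply/imset2P; exists (iter i d v) 0 => //.
      exact: clV.1.
    by rewrite scaler0 addr0.
  by rewrite WrV => /imsetP[u Vu ->]; exists u.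
apply: contraTeq (card_submod_le V) => ntWr; rewrite -ltnNge.
have ltW : tV \proper W r by rewrite properEneq eq_sym ntWr stVW.
have cltV : GRing.submod_closed tV.
  split=> [|a _ _ /imsetP[u Vu ->] /imsetP[u' Vu' ->]].
    by apply/imsetP; exists 0; rewrite ?clV.1 // scaler0.
  apply/imsetP; exists (a *: u + u'); rewrite ?clV.2 //.
  by rewrite scalerDr !scalerA mulrC.
have leW : (residue_card * #|tV| <= #|W r|)%N.
  apply: card_proper_submod => // x Wx.
  by apply/imset_f/(subsetP (sWV r)).
have leV : (residue_card ^ r * (residue_card * #|tV|) <= #|V|)%N.
  by rewrite (leq_trans _ (index r ntWr)) // leq_mul2l leW orbT.
have leT := card_torsion_le_rank rNr tN0.
have leq_tors : (#|tV| * #|torsion| <= #|tV| * residue_card ^ r)%N.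
  by rewrite leq_mul2l leT orbT.
apply: leq_ltn_trans leq_tors _.
(* [residue_card <= 1] only for trivial torsion, where [V] and [tV] already
   have the same cardinal *)
case: (leqP residue_card 1) => [le_q1 | lt1q].
  apply: leq_ltn_trans (_ : #|tV| < _)%N; last first.
    exact: leq_trans (proper_card ltW) (subset_leq_card (sWV r)).
  rewrite -{2}[#|tV|]muln1 leq_mul2l; apply/orP; right.
  move: le_q1; rewrite leq_eqVlt ltnS leqn0 => /orP[] /eqP->; rewrite ?exp1n //.
  by case: (r) => // m; rewrite exp0n.
apply: leq_trans leV.
rewrite [ltnRHS]mulnCA mulnC -{1}[(_ * _)%N]mul1n ltn_mul2r lt1q.
rewrite muln_gt0 expn_gt0 (ltnW lt1q) /=.
by rewrite andbT; apply/card_gt0P; exists 0; apply: cltV.1.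
Qed.
End PrimaryModules.

(** * Powers in a module brace *)

Section BracePowers.
Local Open Scope ring_scope.
Variables (D : idomainType) (N : finLmodType D) (B : moduleBrace N).
Implicit Types x y z : N.

(** Compatibility of [circ] with [0 + 0 = 0] gives [x circ 0 = x]; take for [x]
    the neutral element of [circ]. *)
Lemma circ1_eq0 : circ_one B = 0.
Proof.
have circx0 x : circ B x 0 = x.
  have := circDr B x 0 0; rewrite addr0 -{1}[circ B x 0]add0r => /addIr.
  by move/esym/eqP; rewrite subr_eq0 => /eqP.
by rewrite -[LHS](circx0 (circ_one B)) circ1x.
Qed.

Lemma gamma_is_linear x : linear (gamma B x).
Proof. by have [] := gamma_aut B x. Qed.

Lemma gammaM x y z : gamma B (circ B x y) z = gamma B x (gamma B y z).
Proof.
have gammaB u v : gamma B x (u - v) = gamma B x u - gamma B x v.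
  by rewrite addrC -scaleN1r gamma_is_linear scaleN1r addrC.
rewrite [gamma B y z]addrC gammaB /gamma -circA opprD opprK.
by rewrite addrACA addNr add0r addrC.
Qed.

Lemma gamma1 z : gamma B (circ_one B) z = z.
Proof. by rewrite /gamma circ1x circ1_eq0 oppr0 add0r. Qed.

Definition delta x y := gamma B x y - y.

Lemma delta_is_linear x : linear (delta x).
Proof.
move=> a u v; rewrite /delta gamma_is_linear scalerBr opprD.
by rewrite addrACA.
Qed.

HB.instance Definition _ x :=
  GRing.isLinear.Build D N N _ (delta x) (delta_is_linear x).

Lemma gamma_polyact x v : (1 + 'X) *: (v : polymod (delta x)) = gamma B x v.
Proof. by rewrite scalerDl scale1r polymod_scaleX addrC subrK. Qed.

(** Typed in [N], so that it can be combined with the additive operations. *)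
Definition circ_power x n : N := ((x : circ_group B) ^+ n)%g.

(** Telescoping of [x circ y = x + gamma_x y]. *)
Lemma circ_powerE x n :
  circ_power x n = (\sum_(j < n) (1 + 'X) ^+ j) *: (x : polymod (delta x)).
Proof.
elim: n => [|n IHn].
  by rewrite big_ord0 scale0r /circ_power expg0; apply: circ1_eq0.
have -> : circ_power x n.+1 = x + gamma B x (circ_power x n).
  rewrite /gamma addrCA addKr.
  by rewrite /circ_power expgS.
rewrite IHn -gamma_polyact big_ord_recl [RHS]scalerDl expr0 scale1r.
rewrite scalerA mulr_sumr.
by under [in RHS]eq_bigr => i _ do rewrite exprS.
Qed.

Lemma gamma_power x n v :
  (1 + 'X) ^+ n *: (v : polymod (delta x)) = gamma B (circ_power x n) v.
Proof.
elim: n => [|n IHn].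
  by rewrite expr0 scale1r -[RHS]/(gamma B (circ_one B) v) gamma1.
rewrite exprS -scalerA IHn gamma_polyact -gammaM.
by rewrite /circ_power expgS.
Qed.

Variables (p k : nat).
Hypotheses (p_pr : prime p) (oN : #|N| = (p ^ k)%N).

Lemma mulrn_card (v : N) : v *+ (p ^ k) = 0.
Proof.
by have := expg_cardG (in_setT v); rewrite cardsT oN.
Qed.

Lemma circ_power_card x : circ_power x (p ^ k) = 0.
Proof.
have := expg_cardG (in_setT (x : circ_group B)).
rewrite cardsT -[X in (_ ^+ X)%g]/#|N| oN => xn1.
by rewrite /circ_power xn1; apply: circ1_eq0.
Qed.

(** [(1 + X)^(p^k)] acts as [gamma] of [x^(p^k) = 1], that is, trivially, and it
    is congruent to [1 + X^(p^k)] modulo [p].  So [X^(p^k)] factors through [p],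
    and its [k]-th power through [p^k], which kills [N]. *)
Lemma delta_nilpotent x : exists n, forall v, iter n (delta x) v = 0.
Proof.
pose P := polymod (delta x).
have [h Dh] := exprD1_ppow p_pr ('X : {poly D}) k.
have Xpk (v : P) : 'X^(p ^ k) *: v = p%:R *: (- h *: v).
  have: (1 + 'X) ^+ (p ^ k) *: v = v.
    by rewrite gamma_power circ_power_card -circ1_eq0 gamma1.
  rewrite Dh -addrA scalerDl scale1r -[RHS]addr0 => /addrI/eqP.
  rewrite scalerDl -scalerA addr_eq0 => /eqP->.
  by rewrite scaleNr scalerN.
have Xpkj j (v : P) : exists w : P, 'X^(p ^ k * j) *: v = p%:R ^+ j *: w.
  elim: j => [|j [w IHj]]; first by exists v; rewrite muln0 expr0.
  exists (- h *: w); rewrite mulnS exprD -scalerA IHj scalerA mulrC -scalerA.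
  by rewrite Xpk [LHS]scalerA -exprSr.
exists (p ^ k * k)%N => v; rewrite -polymod_scaleXn.
have [w ->] := Xpkj k v.
by rewrite -natrX polymod_scale_nat; apply: mulrn_card.
Qed.

Hypotheses (D_pid : is_pid D) (pD_prime : prime_element (p%:R : D)).
Variable (r : nat).
Hypotheses (rNr : has_rank N r) (lt_rp : (r < p - 1)%N).

(** The rank bound is applied to the cyclic submodule [V = D[X] x], so that the
    quotient of [X^r x] by [p] is again a polynomial multiple of [x]. *)
Lemma deltaXr x : exists h : {poly D},
  'X^r *: (x : polymod (delta x)) = (p%:R * h) *: (x : polymod (delta x)).
Proof.
pose P := polymod (delta x).
have [n dn0] := delta_nilpotent x.
pose V : {set N} := [set y | `[< exists h : {poly D}, y = h *: (x : P) >]].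
have VP y : reflect (exists h : {poly D}, y = h *: (x : P)) (y \in V).
  by rewrite inE; apply: asboolP.
have clV : GRing.submod_closed V.
  split=> [|a _ _ /VP[h ->] /VP[h' ->]]; apply/VP.
    by exists 0; rewrite scale0r.
  by exists (a%:P * h + h'); rewrite scalerDl -scalerA polymod_scaleC.
have dV y : y \in V -> delta x y \in V.
  by case/VP=> h ->; apply/VP; exists ('X * h); rewrite -scalerA polymod_scaleX.
have Vx : x \in V by apply/VP; exists 1; rewrite scale1r.
have tN0 (y : N) : exists m, (p%:R : D) ^+ m *: y = 0.
  by exists k; rewrite -natrX scaler_nat mulrn_card.
have [u /VP[h ->] Dx] :=
  iter_nilpotent_submod D_pid pD_prime rNr tN0 dn0 clV dV Vx.
exists h; rewrite polymod_scaleXn Dx -scalerA.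
by rewrite -[in RHS]polyC_natr polymod_scaleC.
Qed.

(** The leading term [X^(p - 1)] of the power formula contains [X^(r + 1)]:
    [X^r] yields the factor [p], and one [X] is left for the nilpotent part of
    [1 + X g]. *)
Lemma circ_power_prime x : exists g : {poly D},
    circ_power x p = ((1 + 'X * g) * p%:R) *: (x : polymod (delta x)).
Proof.
have [p_nz _ _] := pD_prime.
have [g Dg] := sum_exprD1X p_pr p_nz; have [h Dh] := deltaXr x.
rewrite circ_powerE Dg.
pose e := (p.-1 - r.+1)%N; exists (g + 'X^e * h).
have -> : (1 + 'X * (g + 'X^e * h)) * p%:R =
          'X^(e + 1) * (p%:R * h) + p%:R * (1 + 'X * g) :> {poly D}.
  by rewrite exprD; ring.
have -> : p.-1 = (e + 1 + r)%N by rewrite /e; move: lt_rp; lia.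
by rewrite exprD !scalerDl -[('X^(e + 1) * 'X^r) *: _]scalerA Dh scalerA.
Qed.

(** The [circ]-power [x^p] differs from [p x] by the operator [1 + X g], which is
    injective since [y = - X g y] iterates to [y = 0]. *)
Lemma circ_power_eq0 m x :
  (circ_power x (p ^ m) == 0) = (x *+ (p ^ m) == 0).
Proof.
elim: m x => [|m IHm] x; first by rewrite expn0 /circ_power expg1 mulr1n.
have -> : circ_power x (p ^ m.+1) = circ_power (circ_power x p) (p ^ m).
  by rewrite /circ_power expnS expgM.
have [g ->] := circ_power_prime x.
rewrite {}IHm.
rewrite -!(polymod_scale_nat (delta x)) scalerA mulrCA -natrM mulnC -expnS -scalerA.
set y := _ *: (x : polymod (delta x)).
apply/eqP/eqP => [y0 | ->]; last exact: (@scaler0 _ (polymod (delta x))).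
have Xgy : y = ('X * - g) *: y.
  by apply/eqP; rewrite -subr_eq0 mulrN scaleNr opprK -{1}[y]scale1r -scalerDl y0.
have Xgny n : y = ('X * - g) ^+ n *: y.
  elim: n => [|n IHn]; first by rewrite expr0 scale1r.
  by rewrite exprS -[RHS]scalerA -IHn.
have [n dn0] := delta_nilpotent x.
by rewrite (Xgny n) exprMn mulrC -scalerA polymod_scaleXn dn0 scaler0.
Qed.

(** Both orders are powers of [p], and they divide the same powers of [p]. *)
Lemma order_circ x : #[x]%g = #[x : circ_group B]%g.
Proof.
have eq_div m : (#[x]%g %| p ^ m)%N = (#[x : circ_group B]%g %| p ^ m)%N.
  rewrite !order_dvdn -[RHS]/(circ_power x (p ^ m) == circ_one B).
  by rewrite circ1_eq0 circ_power_eq0.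
have xk : (#[x]%g %| p ^ k)%N by rewrite order_dvdn; apply/eqP/mulrn_card.
have xk' := xk; rewrite eq_div in xk'.
have /(dvdn_pfactor _ _ p_pr)[a _ Da] := xk.
have /(dvdn_pfactor _ _ p_pr)[b _ Db] := xk'.
by apply/eqP; rewrite eqn_dvd {2}Da -eq_div {1}Db eq_div -Da -Db !dvdnn.
Qed.
End BracePowers.

(** * Abelian p-groups with the same order statistics *)

Section AbelianPGroups.
Local Open Scope group_scope.
Variable (p : nat).
Hypothesis (p_pr : prime p).

Lemma card_Ohm_abelian (gT : finGroupType) (G : {group gT}) n :
  p.-group G -> abelian G ->
  #|'Ohm_n(G)| = #|[set x in G | #[x] %| p ^ n]|.
Proof.
move=> pG cGG; rewrite (OhmEabelian pG (abelianS (Ohm_sub n G) cGG)).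
by apply: eq_card => x; rewrite !inE order_dvdn.
Qed.

(** The multiplicity of [n] is the number of entries at least [n] minus the
    number of entries at least [n + 1]. *)
Lemma sorted_count_eq (s t : seq nat) : sorted geq s -> sorted geq t ->
  (forall n, count (leq n) s = count (leq n) t) -> s = t.
Proof.
move=> ss st eq_st.
have geq_trans : transitive geq by move=> a b c ba cb; apply: leq_trans cb ba.
have geq_anti : antisymmetric geq by move=> a b; rewrite andbC; apply: anti_leq.
apply: (sorted_eq geq_trans geq_anti ss st).
have count1 u n : (count_mem n u + count (leq n.+1) u = count (leq n) u)%N.
  rewrite -count_predUI [X in (_ + X)%N](_ : _ = 0).
    by rewrite addn0; apply: eq_count => m /=; rewrite [RHS]leq_eqVlt eq_sym.
  apply/eqP; rewrite -leqn0 leqNgt -has_count; apply/hasPn=> m _ /=.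
  by apply/negP=> /andP[/eqP->]; rewrite ltnn.
apply/allP => n _ /=; apply/eqP/(@addIn (count (leq n.+1) s)).
by rewrite count1 eq_st -count1 eq_st.
Qed.

(** The exponents of the cyclic factors of [G] can be read off the cardinals of
    the groups ['Ohm_n(G)]: the index of ['Ohm_n(G)] in ['Ohm_n.+1(G)] is [p] to
    the number of factors of order at least [p ^ n.+1]. *)
Lemma pgroup_abelian_type (gT : finGroupType) (G : {group gT}) :
    p.-group G -> abelian G ->
  exists s : seq nat,
    [/\ abelian_type G = [seq p ^ e | e <- s]%N, sorted geq s, all (leq 1) s &
        forall n, count (leq n.+1) s = logn p #|'Ohm_n.+1(G) : 'Ohm_n(G)|].
Proof.
move=> pG cGG; have [b dG Db] := abelian_structure cGG.
pose s := [seq logn p #[x] | x <- b].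
have ordb x : x \in b -> #[x] = (p ^ logn p #[x])%N.
  move=> bx.
  have dvd_xG: #[x] %| #|G| by rewrite -(bigdprod_card dG) (big_rem x) //= dvdn_mulr.
  by have /p_natP[e ->] := pnat_dvd dvd_xG pG; rewrite pfactorK.
have DG : abelian_type G = [seq p ^ e | e <- s]%N.
  by rewrite -Db -map_comp; apply/eq_in_map => x /ordb.
exists s; split=> // [||n].
- have := abelian_type_sorted G; rewrite DG sorted_map.
  by apply: sub_sorted => i j /=; rewrite /geq /= leq_exp2l ?prime_gt1.
- have := abelian_type_gt1 G; rewrite DG all_map; apply: sub_all => e /=.
  by case: e.
- by rewrite -(count_logn_dprod_cycle p n dG) count_map.
Qed.

Lemma abelian_pgroup_isog (gT rT : finGroupType) (G : {group gT}) (H : {group rT}) :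
  p.-group G -> abelian G -> p.-group H -> abelian H ->
  (forall n, #|[set x in G | #[x] %| p ^ n]| = #|[set x in H | #[x] %| p ^ n]|) ->
  G \isog H.
Proof.
move=> pG cGG pH cHH eqGH; rewrite eq_abelian_type_isog //.
have [s [-> ss s_gt0 Ds]] := pgroup_abelian_type pG cGG.
have [t [-> st t_gt0 Dt]] := pgroup_abelian_type pH cHH.
suffices /(sorted_count_eq ss st)-> :
  forall n, count (leq n) s = count (leq n) t by [].
have cS n : count (leq n.+1) s = count (leq n.+1) t.
  by rewrite Ds Dt -!divgS ?Ohm_leq // !card_Ohm_abelian ?eqGH.
case=> [|n] //; have c0 u : count (leq 0) u = size u.
  by rewrite -count_predT; apply: eq_count.
(* all exponents are positive, so the threshold 0 counts as the threshold 1 *)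
move: s_gt0 t_gt0; rewrite !all_count => /eqP Es /eqP Et.
by rewrite !c0 -Es -Et cS.
Qed.
End AbelianPGroups.

Local Open Scope group_scope.

Theorem theorem4p1 (p : nat) (D : idomainType) (N : finLmodType D)
    (B : moduleBrace N) (r : nat) :
  prime p -> is_pid D -> prime_element (p%:R : D)%R ->
  (exists k : nat, #|N| = (p ^ k)%N) ->
  has_rank N r -> (r < p - 1)%N ->
  (forall n : nat,
     #|[set x : N | #[x] == n]| = #|[set x : circ_group B | #[x] == n]|) /\
  (abelian [set: circ_group B] -> [set: N] \isog [set: circ_group B]).
Proof.
move=> p_pr D_pid pD_prime [k oN] rNr lt_rp.
have ord x := order_circ B p_pr oN D_pid pD_prime rNr lt_rp x.
have card_eq (P : pred nat) :
    #|[set x : N | P #[x]]| = #|[set x : circ_group B | P #[x]]|.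
  rewrite -[LHS](@card_imset N (circ_group B) id _ (@inj_id N)).
  apply: eq_card => x; rewrite inE -ord; apply/imsetP/idP => [[y Py ->] | Px].
    by rewrite inE in Py.
  by exists x; rewrite ?inE.
split=> [n | cBB]; first exact: (card_eq (pred1 n)).
have cNN : abelian [set: N] by apply: FinRing.zmod_abelian.
apply: (abelian_pgroup_isog p_pr) => // [||n].
- by rewrite /pgroup cardsT oN pnatX pnat_id.
- by rewrite /pgroup cardsT -[X in _.-nat X]/#|N| oN pnatX pnat_id.
have := card_eq [pred m | m %| p ^ n]%N; rewrite /=.
by congr (_ = _); apply: eq_card => x; rewrite !inE.
Qed.
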